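(* For any Min-$\Phi$-CSP instance $\mathcal{I}$ (with candidate lists) that is symmetric under a group of permutations of its vertices and whose multilinear relaxation has symmetry gap $\gamma$, and for any $\epsilon>0$, there is a Min-$\Phi$-CSP instance $\mathcal{I}'$ (with candidate lists) whose Basic LP has integrality gap at least $(1-\epsilon)\gamma$.
   Context: $\Phi$ is a set of cost functions $\Psi:[q]^j\to[0,1]\cup\{\infty\}$ of bounded arity. An instance has vertex set $V$, candidate lists $L_v\subseteq[q]$, and weighted hyperedges $e=(v_1,\ldots,v_j)$ (ordered tuples of distinct vertices) with cost functions $\Psi_e\in\Phi$ and weights $w_e>0$; a labeling $\ell$ with $\ell(v)\in L_v$ costs $\sum_e w_e\Psi_e(\ell(v_1),\ldots,\ell(v_j))$. The Basic LP has variables $x_{v,a}\in[0,1]$ with $\sum_a x_{v,a}=1$, $x_{v,a}=0$ for $a\notin L_v$, and $x_{e,\alpha}\in[0,1]$ ($\alpha\in[q]^{|e|}$) with $x_{v_p,a}=\sum_{\alpha:\alpha_p=a}x_{e,\alpha}$ for each $e=(v_1,\ldots,v_j)$, position $p$ and label $a$; objective $\min\sum_e w_e\sum_\alpha x_{e,\alpha}\Psi_e(\alpha)$. Its integrality gap is the ratio of the integral optimum to the Basic LP optimum. The multilinear relaxation has fractional solutions $x_{v,a}\ge0$, $\sum_a x_{v,a}=1$, $x_{v,a}=0$ for $a\notin L_v$, with value equal to the expected cost of the random labeling in which each $v$ independently receives label $a$ with probability $x_{v,a}$. An instance is symmetric under a group $\mathcal{G}$ of permutations of $V$ if every $\sigma\in\mathcal{G}$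 preserves candidate lists and maps the weighted collection of constraints onto itself; a fractional solution is symmetric if $x_{\sigma(v),a}=x_{v,a}$ for all $\sigma\in\mathcal{G}$. The symmetry gap is the ratio of the minimum value of the multilinear relaxation over symmetric fractional solutions to its minimum over all fractional solutions. *)

(* Defs.v *)
From HB Require Import structures.
From mathcomp Require Import all_boot all_order all_algebra all_fingroup.
From mathcomp Require Import classical_sets reals constructive_ereal ereal.
Set Implicit Arguments. Unset Strict Implicit. Unset Printing Implicit Defensive.
Import Order.TTheory GRing.Theory Num.Theory.
Local Open Scope ring_scope.
Local Open Scope classical_set_scope.
Local Open Scope ereal_scope.

Section MinCSP.
Variables (R : realType) (q : nat).

Definition cfun := {j : nat & {ffun 'I_j -> 'I_q} -> \bar R}.

Definition bounded_arity (Phi : cfun -> Prop) : Prop :=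
  exists k : nat, forall Psi, Phi Psi -> (projT1 Psi <= k)%N.

Definition cost_range (Phi : cfun -> Prop) : Prop :=
  forall Psi, Phi Psi -> forall alpha,
    (0 <= projT2 Psi alpha <= 1) \/ projT2 Psi alpha = +oo.

Record hedge (V : Type) := Hedge {
  h_ar : nat;
  h_scope : 'I_h_ar -> V;
  h_cost : {ffun 'I_h_ar -> 'I_q} -> \bar R;
  h_weight : R
}.
Arguments h_ar {V} h.
Arguments h_scope {V} h _.
Arguments h_cost {V} h _.
Arguments h_weight {V} h.

Record instance := Instance {
  ivert : finType;
  iedge : finType;
  ilist : ivert -> {set 'I_q};
  iE : iedge -> hedge ivert
}.

Definition instance_over (Phi : cfun -> Prop) (I : instance) : Prop :=
  forall e : iedge I,
    injective (h_scope (iE e)) /\ (0 < h_weight (iE e))%R /\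
    Phi (existT _ (h_ar (iE e)) (h_cost (iE e))).

Definition lab_cost (I : instance) (l : {ffun ivert I -> 'I_q}) : \bar R :=
  \sum_(e : iedge I)
    (h_weight (iE e))%:E * h_cost (iE e) [ffun p => l (h_scope (iE e) p)].

Definition feasible_lab (I : instance) (l : {ffun ivert I -> 'I_q}) : Prop :=
  forall v, l v \in ilist v.

(* Integral optimum (+oo if there is no feasible labeling). *)
Definition int_opt (I : instance) : \bar R :=
  ereal_inf [set c | exists l : {ffun ivert I -> 'I_q}, feasible_lab l /\ c = lab_cost l].

Definition frac_sol (I : instance) (x : ivert I -> 'I_q -> R) : Prop :=
  (forall v a, 0 <= x v a)%R /\
  (forall v, \sum_(a < q) x v a = 1)%R /\
  (forall v a, a \notin ilist v -> x v a = 0%R).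

(* Multilinear value: expected cost of the independent random labeling. *)
Definition ml_value (I : instance) (x : ivert I -> 'I_q -> R) : \bar R :=
  \sum_(l : {ffun ivert I -> 'I_q}) (\prod_(v : ivert I) x v (l v))%:E * lab_cost l.

Definition ml_opt (I : instance) : \bar R :=
  ereal_inf [set c | exists x : ivert I -> 'I_q -> R, frac_sol x /\ c = ml_value x].

Definition hedge_map (V : finType) (s : {perm V}) (h : hedge V) : hedge V :=
  @Hedge V (h_ar h) (fun p => s (h_scope h p)) (h_cost h) (h_weight h).

Definition symmetric_under (I : instance) (G : {group {perm ivert I}}) : Prop :=
  forall s, s \in G ->
    (forall v, ilist (s v) = ilist v) /\
    exists t : iedge I -> iedge I, bijective t /\
      forall e, iE (t e) = hedge_map s (iE e).

Definition sym_sol (I : instance) (G : {group {perm ivert I}})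
    (x : ivert I -> 'I_q -> R) : Prop :=
  forall s, s \in G -> forall v a, x (s v) a = x v a.

Definition sym_ml_opt (I : instance) (G : {group {perm ivert I}}) : \bar R :=
  ereal_inf [set c | exists x : ivert I -> 'I_q -> R, frac_sol x /\ sym_sol G x /\ c = ml_value x].

Definition lp_feasible (I : instance) (x : ivert I -> 'I_q -> R)
    (y : forall e : iedge I, {ffun 'I_(h_ar (iE e)) -> 'I_q} -> R) : Prop :=
  (forall v a, 0 <= x v a <= 1)%R /\
  (forall v, \sum_(a < q) x v a = 1)%R /\
  (forall v a, a \notin ilist v -> x v a = 0%R) /\
  (forall e alpha, 0 <= y e alpha <= 1)%R /\
  (forall e p a, x (h_scope (iE e) p) a = \sum_(alpha : {ffun 'I_(h_ar (iE e)) -> 'I_q} | alpha p == a) y e alpha)%R.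

Definition lp_value (I : instance)
    (y : forall e : iedge I, {ffun 'I_(h_ar (iE e)) -> 'I_q} -> R) : \bar R :=
  \sum_(e : iedge I) (h_weight (iE e))%:E *
     \sum_(alpha : {ffun 'I_(h_ar (iE e)) -> 'I_q}) (y e alpha)%:E * h_cost (iE e) alpha.

Definition lp_opt (I : instance) : \bar R :=
  ereal_inf [set c | exists (x : ivert I -> 'I_q -> R) (y : forall e : iedge I, {ffun 'I_(h_ar (iE e)) -> 'I_q} -> R), lp_feasible x y /\ c = lp_value y].

End MinCSP.

(* Ratio a / b of two optima in \bar R, with the conventions
   0/0 = 1, a/0 = +oo (a <> 0), +oo/+oo = 1, (finite a)/+oo = 0. *)
Definition eratio (R : realType) (a b : \bar R) : \bar R :=
  match b with
  | EFin r => if r == 0%R then (if a == 0 then 1 else +oo) else a * (r^-1)%:E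
  | EPInf => if a == +oo then 1 else 0
  | ENInf => 0
  end.

Definition symmetry_gap (R : realType) (q : nat) (I : instance R q)
  (G : {group {perm ivert I}}) : \bar R :=
  eratio (sym_ml_opt G) (ml_opt I).

Definition integrality_gap (R : realType) (q : nat) (I : instance R q) : \bar R :=
  eratio (int_opt I) (lp_opt I).

(* Main.v *)
Require Import Defs.
From mathcomp Require Import all_boot all_order all_algebra all_fingroup.
From mathcomp Require Import classical_sets reals constructive_ereal ereal.
Import Order.TTheory GRing.Theory Num.Theory.
Local Open Scope ring_scope.
Local Open Scope ereal_scope.

(** Replace every orbit of vertices by [n] interchangeable copies and put, for
    each injection [f : V -> 'I_n], a scaled copy of the instance on the vertices
    (orbit of [v], [f v]).  Averaging an integral solution over the group gives a
    solution of the Basic LP of no larger value, because the marginals only depend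
    on the orbit.  Conversely, the label frequencies of an integral solution of the
    blow-up form a symmetric fractional solution whose multilinear value is the
    average of the costs over all maps [f], not only the injective ones.  To
    control the other maps when costs may be infinite, labels used fewer than [#|V|]
    times in a block are first replaced by popular ones: every combination of
    popular labels occurs at some injection, so it has finite cost, hence cost at
    most the total weight, and only a fraction [O(1/n)] of the maps is affected. *)

(** * Counting the maps that are not injective or meet rare labels *)

Section Counting.
Set Implicit Arguments.
Unset Strict Implicit.
Local Open Scope nat_scope.

Lemma ffact_leq_expn (n k : nat) : n ^_ k <= n ^ k.
Proof.
elim: k => [|k IHk]; first by rewrite ffactn0 expn0.
by rewrite ffactnSr expnSr leq_mul // leq_subr.
Qed.

(** Each induction step loses at most [k * n ^ k.+1], and [k ^ 2 + k <= k.+1 ^ 2]. The extra factor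
    [n] expresses an O(1/n) fraction without division. *)
Lemma expn_leq_ffact (n k : nat) : n * n ^ k <= n * n ^_ k + k ^ 2 * n ^ k.
Proof.
elim: k => [|k IHk]; first by rewrite ffactn0 expn0 leq_addr.
have le_n : n <= (n - k) + k by rewrite addnC -leq_subLR.
have H1 : n * n ^ k.+1 <= (n * n ^_ k) * n + k ^ 2 * n ^ k.+1.
  by rewrite expnSr !mulnA -mulnDl leq_mul2r IHk orbT.
have H2 : (n * n ^_ k) * n <= n * n ^_ k.+1 + k * n ^ k.+1.
  apply: leq_trans (leq_mul (leqnn _) le_n) _.
  rewrite mulnDr ffactnSr mulnA leq_add2l mulnC leq_mul2l expnS.
  by rewrite leq_mul2l ffact_leq_expn !orbT.
apply: leq_trans H1 _; apply: leq_trans (leq_add H2 (leqnn _)) _.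
rewrite -addnA leq_add2l -mulnDl leq_mul2r; apply/orP; right.
by rewrite -(addn1 k) sqrnD muln1 exp1n addnC -!addnA leq_add2l mul2n -addnn addnCA leq_addr.
Qed.

Lemma card_noninjective_ffun (V : finType) (n : nat) :
  n * #|[set f : {ffun V -> 'I_n} | ~~ injectiveb f]| <= #|V| ^ 2 * n ^ #|V|.
Proof.
have := expn_leq_ffact n #|V|.
have -> : n ^_ #|V| = #|[set f : {ffun V -> 'I_n} | injectiveb f]|.
  by rewrite card_inj_ffuns card_ord.
have -> : [set f : {ffun V -> 'I_n} | ~~ injectiveb f]
  = ~: [set f : {ffun V -> 'I_n} | injectiveb f].
  by apply/setP => f; rewrite !inE.
have {1}-> : n ^ #|V| = #|{ffun V -> 'I_n}| by rewrite card_ffun card_ord.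
by rewrite -(cardsC [set f : {ffun V -> 'I_n} | injectiveb f]) mulnDr leq_add2l.
Qed.

Lemma card_ffun_at (V : finType) (n : nat) (v : V) (A : {set 'I_n}) :
  n * #|[set f : {ffun V -> 'I_n} | f v \in A]| = #|A| * n ^ #|V|.
Proof.
pose F (u : V) := [pred i : 'I_n | (u == v) ==> (i \in A)].
have -> : #|[set f : {ffun V -> 'I_n} | f v \in A]| = #|family F|.
  rewrite cardsE; apply: eq_card => f; rewrite [LHS]inE.
  apply/idP/familyP => [fv u|/(_ v)]; rewrite inE ?eqxx //.
  by apply/implyP => /eqP ->.
rewrite card_family foldrE big_map big_enum /= (bigD1 v) //=.
have -> : #|F v| = #|A| by apply: eq_card => i; rewrite !inE eqxx.
rewrite (eq_bigr (fun _ => n)); last first.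
  move=> u uv; rewrite -[RHS]card_ord; apply: eq_card => i.
  by rewrite !inE (negPf uv).
rewrite prod_nat_const mulnCA -expnS; congr (_ * _ ^ _).
by rewrite cardC1 prednK //; apply/card_gt0P; exists v.
Qed.

(* Greedy choice: fewer than [#|V|] values are excluded at each step. *)
Lemma injective_choice (V T : finType) (A : V -> {set T}) (f0 : V -> T) :
  (forall v, #|V| <= #|A v|) ->
  exists2 f : {ffun V -> T}, injective f & forall v, f v \in A v.
Proof.
move=> leA.
suff [f [finj fA]] : exists f : V -> T,
    {in enum V &, injective f} /\ {in enum V, forall v, f v \in A v}.
  exists (finfun f) => [u v|v]; rewrite ?ffunE; last by apply: fA; rewrite mem_enum.
  by apply: finj; rewrite mem_enum.
elim: (enum V) (enum_uniq V) => [|v s IHs] /=; first by exists f0.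
case/andP=> vs /[dup] us /IHs [f [finj fA]].
have [t tA tf] : exists2 t, t \in A v & t \notin [set f u | u in s].
  apply/subsetPn/negP => /subset_leq_card; apply/negP; rewrite -ltnNge.
  apply: leq_trans (leA v); apply: leq_ltn_trans (leq_imset_card _ _) _.
  rewrite (card_uniqP us).
  have /card_uniqP /= <- : uniq (v :: s) by rewrite /= vs.
  exact: max_card.
exists (fun u => if u == v then t else f u); split=> [u w|u]; rewrite !inE.
  case: (eqVneq u v) => [->|_]; case: (eqVneq w v) => [->|_] //=.
  - by move=> _ ws tE; case/negP: tf; apply/imsetP; exists w.
  - by move=> us' _ tE; case/negP: tf; apply/imsetP; exists u.
  - exact: finj.
by case: (eqVneq u v) => [->|_] //= us'; apply: fA.
Qed.

Variables (n q k : nat).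

Definition fiber (u : 'I_n -> 'I_q) (a : 'I_q) : {set 'I_n} := [set i | u i == a].

(** Later [k] is the number of vertices, the fiber size that [injective_choice] asks for. *)
Definition popular (u : 'I_n -> 'I_q) (i : 'I_n) : bool := k <= #|fiber u (u i)|.

(* When no index is popular, [prune] is the identity; [q * k < n] excludes this. *)
Definition prune (u : 'I_n -> 'I_q) (i : 'I_n) : 'I_n :=
  if popular u i then i else odflt i [pick j | popular u j].

(** Each of the [q] labels accounts for at most [k] such indices: its fiber is either wholly popular
    or smaller than [k]. *)
Lemma card_unpopular (u : 'I_n -> 'I_q) : #|[set i | ~~ popular u i]| <= q * k.
Proof.
rewrite -sum1dep_card (partition_big u predT) //=.
rewrite -[X in _ <= X * _](card_ord q) -sum_nat_const; apply: leq_sum => a _.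
rewrite sum1dep_card.
case: (leqP k #|fiber u a|) => [le_k|lt_k].
  rewrite (_ : [set _ | _] = finset.set0) ?cards0 //; apply/setP => i.
  by rewrite !inE /popular; case: eqP => [->|]; rewrite ?le_k ?andbF.
apply: leq_trans (ltnW lt_k); apply/subset_leq_card/fintype.subsetP => i.
by rewrite !inE => /andP[].
Qed.

Lemma prune_popular (u : 'I_n -> 'I_q) (i : 'I_n) : q * k < n -> popular u (prune u i).
Proof.
move=> lt_n; rewrite /prune; case: ifP => // _; case: pickP => //= unpop.
have := card_unpopular u; rewrite leqNgt; case/negP.
rewrite (_ : [set j | ~~ popular u j] = [set: 'I_n]) ?cardsT ?card_ord //.
by apply/setP => j; rewrite !inE unpop.
Qed.

(** Union bound over the failure of injectivity and, for each vertex, the at most [q * k] unpopular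
    indices. *)
Lemma card_unpruned (V : finType) (g : V -> 'I_n -> 'I_q) :
  n * #|[set f : {ffun V -> 'I_n} |
          ~~ (injectiveb f && [forall v, popular (g v) (f v)])]|
    <= (#|V| ^ 2 + #|V| * (q * k)) * n ^ #|V|.
Proof.
have sub : [set f : {ffun V -> 'I_n} |
      ~~ (injectiveb f && [forall v, popular (g v) (f v)])] \subset
    [set f : {ffun V -> 'I_n} | ~~ injectiveb f] :|:
    \bigcup_v [set f : {ffun V -> 'I_n} | f v \in [set i | ~~ popular (g v) i]].
  apply/fintype.subsetP => f; rewrite !inE negb_and negb_forall.
  case/orP => [->//|/existsP[v pv]]; apply/orP; right.
  by apply/bigcupP; exists v => //; rewrite !inE.
have le_bigcup : n * #|\bigcup_v [set f : {ffun V -> 'I_n} | f v \in [set i | ~~ popular (g v) i]]|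
    <= \sum_(v : V) q * k * n ^ #|V|.
  apply: (big_ind2 (fun (B : {set {ffun V -> 'I_n}}) m => n * #|B| <= m)).
  - by rewrite cards0 muln0.
  - move=> B1 m1 B2 m2 le1 le2.
    apply: leq_trans (leq_add le1 le2); rewrite -mulnDr leq_mul2l.
    by rewrite -cardsUI leq_addr orbT.
  - by move=> v _; rewrite card_ffun_at leq_mul2r card_unpopular orbT.
apply: leq_trans (leq_mul (leqnn n) (subset_leq_card sub)) _.
apply: leq_trans (leq_mul (leqnn n) (leq_card_setU _ _)) _.
rewrite mulnDr mulnDl leq_add ?card_noninjective_ffun //.
by rewrite sum_nat_const mulnA in le_bigcup.
Qed.

End Counting.

(** * Empirical distributions *)

Section Frequency.
Set Implicit Arguments.
Unset Strict Implicit.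
Variables (R : realType) (S T : finType) (A : {set S}) (L : S -> T).

(** The law of [L s] for [s] uniform in [A], used with [A] the group, all indices, or all maps. *)
Definition freq (t : T) : R := (#|A|%:R^-1 * \sum_(s in A) (L s == t)%:R)%R.

Lemma freq_ge0 t : (0 <= freq t)%R.
Proof. by rewrite mulr_ge0 ?invr_ge0 ?sumr_ge0. Qed.

Lemma freq_eq0 t : (forall s, s \in A -> L s != t) -> freq t = 0%R.
Proof.
by move=> nLt; rewrite /freq big1 ?mulr0 // => s /nLt /negPf ->.
Qed.

(** With [Q] fixing one coordinate of a tuple, this computes the marginals of a joint law. *)
Lemma sum_freq (Q : pred T) :
  (\sum_(t | Q t) freq t = #|A|%:R^-1 * \sum_(s in A) (Q (L s))%:R)%R.
Proof.
rewrite -mulr_sumr exchange_big; congr (_ * _)%R; apply: eq_bigr => s _ /=.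
rewrite (bigID (pred1 (L s))) /= [X in (_ + X)%R]big1 => [|t /andP[_ nt]].
  rewrite addr0 big_mkcondr /=; case Qs: (Q (L s)).
    rewrite (bigD1 (L s)) //= !eqxx big1 ?addr0 // => t /andP[_ /negPf ->].
    by [].
  by apply: big1 => t Qt; case: eqP => // tL; rewrite tL Qs in Qt.
by rewrite eq_sym (negPf nt).
Qed.

Lemma sum_freq1 : (0 < #|A|)%N -> (\sum_t freq t = 1)%R.
Proof.
move=> A0; rewrite sum_freq sumr_const mulVf //.
by rewrite pnatr_eq0 -lt0n.
Qed.

Lemma freq_le1 t : (freq t <= 1)%R.
Proof.
have [A0|A0] := posnP #|A|; first by rewrite /freq A0 invr0 mul0r.
rewrite -(sum_freq1 A0) (bigD1 t) //= lerDl sumr_ge0 // => u _.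
exact: freq_ge0.
Qed.

(** Distributivity needs only nonnegative coefficients, so [F] may take infinite values. *)
Lemma expectation_freq (F : T -> \bar R) :
  \sum_t (freq t)%:E * F t = \sum_(s in A) (#|A|%:R^-1)%:E * F (L s).
Proof.
under eq_bigr => t _.
  rewrite /freq mulr_sumr -sumEFin ge0_sume_distrl; last first.
    by move=> s _; rewrite lee_fin mulr_ge0 ?invr_ge0.
  over.
rewrite exchange_big; apply: eq_bigr => s _ /=.
rewrite (bigD1 (L s)) //= eqxx mulr1 big1 ?adde0 // => t /negPf.
by rewrite eq_sym => ->; rewrite mulr0 mul0e.
Qed.

End Frequency.

(** * Canonical representatives of vertex orbits *)

Section OrbitRep.
Set Implicit Arguments.
Unset Strict Implicit.
Variables (V : finType) (G : {group {perm V}}).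

Definition orbit_rep (v : V) : V := odflt v [pick u in orbit 'P G v].

Lemma orbit_repE (v : V) : exists2 s, s \in G & orbit_rep v = s v.
Proof.
rewrite /orbit_rep; case: pickP => [u /orbitP[s sG <-]|_] /=; first by exists s.
by exists 1%g; rewrite ?group1 ?perm1.
Qed.

(** [pick] sees only the orbit, which [s v] and [v] share; the differing defaults are never reached,
    as an orbit is nonempty. *)
Lemma orbit_rep_act (s : {perm V}) (v : V) : s \in G -> orbit_rep (s v) = orbit_rep v.
Proof.
move=> sG; have sv : s v \in orbit 'P G v by apply/orbitP; exists s.
rewrite /orbit_rep (orbit_eqP sv); case: pickP => //= none.
by have := none v; rewrite orbit_refl.
Qed.

End OrbitRep.

(** * The blow-up and its labeling costs *)

Section Blowup.
Set Implicit Arguments.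
Unset Strict Implicit.
Variables (R : realType) (q : nat).
Local Arguments h_ar {R q V} h.
Local Arguments h_scope {R q V} h _.
Local Arguments h_cost {R q V} h _.
Local Arguments h_weight {R q V} h.
Implicit Type I : instance R q.

Definition edge_cost (V : finType) (h : hedge R q V) (l : {ffun V -> 'I_q}) : \bar R :=
  (h_weight h)%:E * h_cost h [ffun p => l (h_scope h p)].

Lemma lab_costE I (l : {ffun ivert I -> 'I_q}) :
  lab_cost l = \sum_(e : iedge I) edge_cost (iE e) l.
Proof. by []. Qed.

Lemma edge_cost_hedge_map (V : finType) (s : {perm V}) (h : hedge R q V) l :
  edge_cost (hedge_map s h) l = edge_cost h [ffun v => l (s v)].
Proof.
rewrite /edge_cost /=; congr (_ * h_cost h _).
by apply/ffunP => p; rewrite !ffunE.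
Qed.

Lemma lab_cost_symmetric I (G : {group {perm ivert I}}) s (l : {ffun ivert I -> 'I_q}) :
  symmetric_under G -> s \in G -> lab_cost [ffun v => l (s v)] = lab_cost l.
Proof.
move=> symG /symG [_ [t [tbij tE]]]; rewrite !lab_costE [RHS](reindex t) /=.
  by apply: eq_bigr => e _; rewrite tE edge_cost_hedge_map.
exact: onW_bij.
Qed.

Section Costs.
Variables (Phi : cfun R q -> Prop) (I : instance R q).
Hypotheses (Phi01 : cost_range Phi) (IPhi : instance_over Phi I).

Lemma h_cost_ge0 (e : iedge I) alpha : 0 <= h_cost (iE e) alpha.
Proof.
have [_ [_ PhiE]] := IPhi e.
by case: (Phi01 PhiE alpha) => /= [/andP[]|->].
Qed.

Lemma edge_cost_ge0 (e : iedge I) l : 0 <= edge_cost (iE e) l.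
Proof.
have [_ [w0 _]] := IPhi e.
by rewrite mule_ge0 ?lee_fin ?(ltW w0) ?h_cost_ge0.
Qed.

Lemma lab_cost_ge0 (l : {ffun ivert I -> 'I_q}) : 0 <= lab_cost l.
Proof. by apply: sume_ge0 => e _; exact: edge_cost_ge0. Qed.

Definition total_weight : R := (\sum_(e : iedge I) h_weight (iE e))%R.

(** One infinite constraint of positive weight makes the whole cost infinite, so finiteness bounds
    every constraint cost by 1. *)
Lemma lab_cost_le_total_weight (l : {ffun ivert I -> 'I_q}) :
  lab_cost l != +oo -> lab_cost l <= total_weight%:E.
Proof.
move=> finl; rewrite /total_weight -sumEFin lab_costE; apply: lee_sum => e _.
have [_ [w0 PhiE]] := IPhi e; rewrite /edge_cost.
have /= [/andP[_ c1]|cy] := Phi01 PhiE [ffun p => l (h_scope (iE e) p)].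
  by rewrite -[leRHS]mule1 lee_wpmul2l // lee_fin ltW.
case/eqP: finl; apply/eqP; rewrite -leye_eq lab_costE (bigD1 e) //= /edge_cost cy.
rewrite gt0_muley ?lte_fin // leeDl // sume_ge0 // => e' _; exact: edge_cost_ge0.
Qed.

End Costs.

(* Indexing the copies of an edge by injections of the whole vertex set, rather than
   of its scope, repeats each edge; the cost of a labeling is then an average of
   labeling costs of [I]. *)
Definition blowup I (r : ivert I -> ivert I) (n : nat) : instance R q :=
  @Instance R q (ivert I * 'I_n)%type
    (iedge I * {f : {ffun ivert I -> 'I_n} | injectiveb f})%type
    (fun v => ilist v.1)
    (fun ef => @Hedge R q (ivert I * 'I_n)%type (h_ar (iE ef.1))
       (fun p => (r (h_scope (iE ef.1) p), val ef.2 (h_scope (iE ef.1) p)))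
       (h_cost (iE ef.1))
       (h_weight (iE ef.1) / (n ^ #|ivert I|)%:R)).

(** [r] may merge vertices of one scope, but the injection still keeps their copies apart. *)
Lemma blowup_over Phi I r n : (0 < n)%N ->
  instance_over Phi I -> instance_over Phi (@blowup I r n).
Proof.
move=> n0 IPhi [e [f finj]]; have [sinj [w0 PhiE]] := IPhi e; split=> /=.
  by move=> p p' [_ /(injectiveP _ finj) /sinj].
by rewrite divr_gt0 // ltr0n expn_gt0 n0.
Qed.

(** Defined for every map [f], since rounding also meets maps that are not injective. *)
Definition pull I (r : ivert I -> ivert I) (n : nat) (l : {ffun ivert I * 'I_n -> 'I_q})
    (f : {ffun ivert I -> 'I_n}) : {ffun ivert I -> 'I_q} :=
  [ffun v => l (r v, f v)].

(** The sum runs over injections but is normalised by the number of all maps, so this is an average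
    with some terms missing. *)
Lemma lab_cost_blowup Phi I r n (l : {ffun ivert (@blowup I r n) -> 'I_q}) :
  cost_range Phi -> instance_over Phi I ->
  lab_cost l = ((n ^ #|ivert I|)%:R^-1)%:E *
    \sum_(f : {ffun ivert I -> 'I_n} | injectiveb f) lab_cost (pull r l f).
Proof.
move=> Phi01 IPhi; rewrite ge0_sume_distrr; last first.
  by move=> f _; apply: lab_cost_ge0 Phi01 IPhi _.
rewrite (reindex_omap (val : {f : {ffun ivert I -> 'I_n} | injectiveb f} -> _) insub) /=;
  last by move=> f finj; rewrite insubT.
rewrite [RHS](eq_bigl predT) => [|f]; last by rewrite (valP f) valK eqxx.
have -> : lab_cost l = \sum_(e : iedge I)
    \sum_(f : {f : {ffun ivert I -> 'I_n} | injectiveb f})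
      edge_cost (iE (i := blowup r n) (e, f)) l.
  by rewrite pair_bigA; apply: eq_bigr => -[].
rewrite exchange_big /=.
apply: eq_bigr => f _; rewrite ge0_sume_distrr; last first.
  by move=> e _; apply: edge_cost_ge0 Phi01 IPhi _ _.
apply: eq_bigr => e _; rewrite /edge_cost /= muleA -EFinM mulrC.
by congr (_ * h_cost _ _); apply/ffunP => p; rewrite !ffunE.
Qed.

(** * Upper bound on the Basic LP optimum of the blow-up *)

Section LPValue.
Variables (Phi : cfun R q -> Prop) (I : instance R q) (G : {group {perm ivert I}}).
Hypotheses (Phi01 : cost_range Phi) (IPhi : instance_over Phi I).
Hypothesis symG : symmetric_under G.
Variable n : nat.
Hypothesis n_gt0 : (0 < n)%N.

Lemma lp_opt_ge0 (J : instance R q) : instance_over Phi J -> 0 <= lp_opt J.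
Proof.
move=> JPhi; apply/ereal_infP => _ [x [y [[_ [_ [_ [y01 _]]]] ->]]].
apply: sume_ge0 => e _; have [_ [w0 _]] := JPhi e.
rewrite mule_ge0 ?lee_fin ?(ltW w0) //; apply: sume_ge0 => alpha _.
by rewrite mule_ge0 ?(h_cost_ge0 Phi01 JPhi) // lee_fin; case/andP: (y01 e alpha).
Qed.

(** For [s] uniform in [G], a copy of [v] gets the law of [l (s v)] and each edge the joint law of
    [l] after [s] on its original scope. *)
Lemma lp_opt_blowup_le_lab_cost (l : {ffun ivert I -> 'I_q}) :
  feasible_lab l -> lp_opt (blowup (orbit_rep G) n) <= lab_cost l.
Proof.
move=> lfeas.
have G0 : (0 < #|G|)%N by rewrite cardG_gt0.
pose x (vi : ivert I * 'I_n) (a : 'I_q) : R := freq R G (fun s => l (s vi.1)) a.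
pose L (e : iedge I) (s : {perm ivert I}) : {ffun 'I_(h_ar (iE e)) -> 'I_q} :=
  [ffun p => l (s (h_scope (iE e) p))].
pose y (ef : iedge (blowup (orbit_rep G) n)) : {ffun 'I_(h_ar (iE ef)) -> 'I_q} -> R :=
  freq R G (L ef.1).
apply: ge_ereal_inf; exists (lp_value y).
  exists x, y; split=> //; split; [|split; [|split; [|split]]].
  - by move=> v a; rewrite freq_ge0 freq_le1.
  - by move=> v; rewrite sum_freq1.
  - move=> v a /= aL; apply: freq_eq0 => s sG; apply: contra aL => /eqP <-.
    by have [<- _] := symG sG; apply: lfeas.
  - by move=> e alpha; rewrite freq_ge0 freq_le1.
  - move=> [e f] p a /=; rewrite sum_freq.
    (* The representative is [t v]; translating the summation over [G] by [t] turns its law into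
       that of [v]. *)
    have [t tG tE] := orbit_repE G (h_scope (iE e) p).
    rewrite /x /freq tE; congr (_ * _)%R.
    rewrite [RHS](reindex_inj (mulgI t)) /=; apply: eq_big => s.
      by rewrite groupMl.
    by move=> _; rewrite ffunE permM.
set N : R := (n ^ #|ivert I|)%:R.
have N_gt0 : (0 < N)%R by rewrite ltr0n expn_gt0 n_gt0.
pose c : R := (N^-1 * #|G|%:R^-1)%R.
have c_ge0 : (0 <= c)%R by rewrite mulr_ge0 ?invr_ge0 // ltW.
have -> : lp_value y =
    \sum_(ef : iedge (blowup (orbit_rep G) n)) \sum_(s in G)
      c%:E * edge_cost (iE ef.1) [ffun v => l (s v)].
  apply: eq_bigr => -[e f] _; rewrite expectation_freq ge0_sume_distrr; last first.
    by move=> s _; rewrite mule_ge0 ?(h_cost_ge0 Phi01 IPhi) // lee_fin invr_ge0.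
  apply: eq_bigr => s _; rewrite /edge_cost /= !muleA -!EFinM.
  have -> : [ffun p => [ffun v => l (s v)] (h_scope (iE e) p)] = L e s.
    by apply/ffunP => p; rewrite !ffunE.
  congr (_%:E * _).
  by rewrite [RHS]mulrC mulrA.
rewrite -(pair_bigA _ (fun e (f : {f : {ffun ivert I -> 'I_n} | injectiveb f}) =>
  \sum_(s in G) c%:E * edge_cost (iE e) [ffun v => l (s v)])) exchange_big /=.
have avg (f : {f : {ffun ivert I -> 'I_n} | injectiveb f}) :
    \sum_(e : iedge I) \sum_(s in G) c%:E * edge_cost (iE e) [ffun v => l (s v)]
    = (N^-1)%:E * lab_cost l.
  rewrite exchange_big /=.
  transitivity (\sum_(s in G) c%:E * lab_cost l).
    apply: eq_bigr => s sG; rewrite -(lab_cost_symmetric l symG sG) lab_costE.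
    by rewrite ge0_sume_distrr // => e _; apply: edge_cost_ge0 Phi01 IPhi _ _.
  rewrite -ge0_sume_distrl ?sumEFin ?sumr_const; last by move=> s _; rewrite lee_fin.
  rewrite -[(c *+ _)%R]mulr_natr -mulrA mulVf ?mulr1 //.
  by rewrite pnatr_eq0 -lt0n.
rewrite (eq_bigr _ (fun f _ => avg f)).
rewrite -ge0_sume_distrl ?sumEFin ?sumr_const; last first.
  by move=> s _; rewrite lee_fin invr_ge0 ltW.
(* There are at most [n ^ #|ivert I|] injections, so their total normalised weight is at most 1. *)
rewrite -[leRHS]mul1e lee_wpmul2r ?(lab_cost_ge0 Phi01 IPhi) // lee_fin.
rewrite -[leLHS]mulr_natr ler_pdivrMl // mulr1 ler_nat card_sig.
by apply: leq_trans (max_card _) _; rewrite card_ffun card_ord.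
Qed.

(** A multilinear value is a convex combination of labeling costs in which infeasible labelings have
    probability zero. *)
Lemma lp_opt_blowup : lp_opt (blowup (orbit_rep G) n) <= ml_opt I.
Proof.
apply/ereal_infP => _ [x [[x0 [x1 xL]] ->]].
set b := lp_opt _.
have b0 : 0 <= b by apply: lp_opt_ge0; exact: blowup_over.
have prod_ge0 (l : {ffun ivert I -> 'I_q}) : 0 <= (\prod_v x v (l v))%:E.
  by rewrite lee_fin prodr_ge0.
have -> : b = \sum_(l : {ffun ivert I -> 'I_q}) (\prod_v x v (l v))%:E * b.
  rewrite -ge0_sume_distrl // sumEFin -bigA_distr_bigA /= big1 ?mul1e //.
apply: lee_sum => l _.
case: (boolP [forall v, l v \in ilist v]) => [/forallP lfeas|].
  by rewrite lee_wpmul2l // lp_opt_blowup_le_lab_cost.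
rewrite negb_forall => /existsP[v lv].
by rewrite (bigD1 v) //= xL // mul0r !mul0e.
Qed.

End LPValue.

(** * Lower bound on the integral optimum of the blow-up *)

Section Rounding.
Variables (Phi : cfun R q -> Prop) (I : instance R q) (G : {group {perm ivert I}}).
Hypotheses (Phi01 : cost_range Phi) (IPhi : instance_over Phi I).
Hypothesis symG : symmetric_under G.
Variable n : nat.

Let k := #|ivert I|.
Let error : nat := (k ^ 2 + k * (q * k))%N.

(** The values of a uniformly random map are independent and uniform. *)
Lemma prod_freq (g : ivert I -> 'I_n -> 'I_q) (l : {ffun ivert I -> 'I_q}) :
  (\prod_v freq R finset.setT (g v) (l v))%R =
  freq R finset.setT (fun f : {ffun ivert I -> 'I_n} => [ffun v => g v (f v)]) l.
Proof.
rewrite /freq big_split /= prodr_const exprVn; congr (_ * _)%R.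
  by rewrite !cardsT card_ffun natrX.
under eq_bigr do rewrite big_set /=.
rewrite bigA_distr_bigA /= big_set /=; apply: eq_bigr => f _.
case: eqP => [<-|neq]; first by apply: big1 => v _; rewrite ffunE eqxx.
have [v gv] : exists v, g v (f v) != l v.
  apply/existsP; rewrite -negb_forall; apply/negP => /forallP gl.
  by apply: neq; apply/ffunP => v; rewrite ffunE; apply/eqP.
by rewrite (bigD1 v) //= (negPf gv) mul0r.
Qed.

Lemma ml_value_freq (g : ivert I -> 'I_n -> 'I_q) :
  ml_value (fun v => freq R finset.setT (g v)) =
  ((n ^ k)%:R^-1)%:E *
    \sum_(f : {ffun ivert I -> 'I_n}) lab_cost (I := I) [ffun v => g v (f v)].
Proof.
rewrite /ml_value.
under eq_bigr do rewrite prod_freq.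
rewrite expectation_freq big_set /= cardsT card_ffun card_ord.
by rewrite ge0_sume_distrr // => f _; apply: lab_cost_ge0 Phi01 IPhi _.
Qed.

Lemma sym_ml_opt_le_blowup (l : {ffun ivert (blowup (orbit_rep G) n) -> 'I_q}) :
  (q * k < n)%N -> feasible_lab l -> lab_cost l != +oo ->
  sym_ml_opt G <= lab_cost l + (total_weight I * error%:R / n%:R)%:E.
Proof.
move=> lt_n lfeas; rewrite (lab_cost_blowup _ Phi01 IPhi) -/k.
have n0 : (0 < n)%N by apply: leq_ltn_trans lt_n.
set N : R := (n ^ k)%:R; set C := \sum_(f | _) _ => finl.
have N_gt0 : (0 < N)%R by rewrite ltr0n expn_gt0 n0.
have Cfin : C != +oo.
  by apply: contra finl => /eqP ->; rewrite gt0_muley // lte_fin invr_gt0.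
(* [u v] depends only on the orbit of [v], which makes the frequencies of [g] symmetric. *)
pose u v (i : 'I_n) : 'I_q := l (orbit_rep G v, i).
pose g v i : 'I_q := u v (prune k (u v) i).
pose L (f : {ffun ivert I -> 'I_n}) : {ffun ivert I -> 'I_q} := [ffun v => g v (f v)].
have pull_fin (f : {ffun ivert I -> 'I_n}) : injectiveb f -> lab_cost (I := I) (pull (orbit_rep G) l f) != +oo.
  move=> finj; apply: contra Cfin => /eqP fy; rewrite -leye_eq /C (bigD1 f) //= fy.
  by rewrite leeDl // sume_ge0 // => f' _; apply: lab_cost_ge0 Phi01 IPhi _.
have L_le f : lab_cost (I := I) (L f) <= (total_weight I)%:E.
  apply: (lab_cost_le_total_weight Phi01 IPhi).
  (* Pruned labels have fibers of size at least [k], so some injection [f'] reads the same labels as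
     [L f]; its cost is a term of the finite sum [C]. *)
  have [|f' f'inj f'E] := @injective_choice _ _ (fun v => fiber (u v) (g v (f v))) f.
    by move=> v; exact: prune_popular.
  rewrite (_ : L f = pull (orbit_rep G) l f'); first exact/pull_fin/injectiveP.
  by apply/ffunP => v; have := f'E v; rewrite !ffunE inE => /eqP.
pose good (f : {ffun ivert I -> 'I_n}) :=
  injectiveb f && [forall v, popular k (u v) (f v)].
have weight_ge0 : (0 <= total_weight I)%R.
  by apply: sumr_ge0 => e _; have [_ [/ltW]] := IPhi e.
(* On good maps pruning changes nothing, so their costs occur in [C]; each other map costs at most
   the total weight. *)
have ml_le : \sum_f lab_cost (I := I) (L f) <=
    C + (total_weight I * #|[set f | ~~ good f]|%:R)%:E.
  rewrite (bigID good) /=; apply: leeD.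
    apply: le_trans (_ : \sum_(f | good f) lab_cost (I := I) (pull (orbit_rep G) l f) <= _).
      apply: lee_sum => f /andP[_ /forallP fpop].
      rewrite (_ : L f = pull (orbit_rep G) l f) //.
      by apply/ffunP => v; rewrite !ffunE /g /prune fpop.
    apply: lee_sum_nneg_subset => f; first by case/andP.
    by move=> _; apply: lab_cost_ge0 Phi01 IPhi _.
  apply: le_trans (_ : \sum_(f | ~~ good f) (total_weight I)%:E <= _).
    by apply: lee_sum => f _; exact: L_le.
  rewrite sumEFin sumr_const mulr_natr lee_fin le_eqVlt; apply/orP; left.
  by apply/eqP; congr (_ *+ _)%R; rewrite cardsE.
apply: le_trans (_ : ml_value (fun v => freq R finset.setT (g v)) <= _).
  apply: ge_ereal_inf; exists (ml_value (fun v => freq R finset.setT (g v))) => //.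
  exists (fun v => freq R finset.setT (g v)); split; last split=> //.
    split; first by move=> v a; exact: freq_ge0.
    split=> [v|v a aL]; first by rewrite sum_freq1 // cardsT card_ord.
    apply: freq_eq0 => i _; apply: contra aL => /eqP <-.
    have [s sG sE] := orbit_repE G v; have [<- _] := symG sG.
    by rewrite -sE; apply: lfeas.
  by move=> s sG v a; rewrite /freq /g /u orbit_rep_act.
rewrite ml_value_freq -/N.
apply: le_trans (lee_wpmul2l _ ml_le) _; first by rewrite lee_fin invr_ge0 ltW.
rewrite ge0_muleDr; last 2 first.
- by apply: sume_ge0 => f _; apply: lab_cost_ge0 Phi01 IPhi _.
- by rewrite lee_fin mulr_ge0.
rewrite leeD2l // -EFinM lee_fin mulrCA -!mulrA ler_wpM2l //.
rewrite ler_pdivlMr ?ltr0n // -mulrA ler_pdivrMl // -!natrM ler_nat.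
by rewrite mulnC [leqRHS]mulnC card_unpruned.
Qed.

(** The lower bound on [n] makes the additive rounding error at most [eps] times the symmetric
    optimum. If that optimum is infinite, no feasible labeling of the blow-up has finite cost. *)
Lemma int_opt_blowup (eps : R) : (0 < eps)%R -> (q * k < n)%N ->
  (total_weight I * error%:R / (eps * fine (sym_ml_opt G)) < n%:R)%R ->
  (1 - eps)%:E * sym_ml_opt G <= int_opt (blowup (orbit_rep G) n).
Proof.
move=> eps0 lt_n; have n0 : (0 < n)%N by apply: leq_ltn_trans lt_n.
have S0 : 0 <= sym_ml_opt G.
  apply/ereal_infP => _ [x [[x0 _] [_ ->]]]; apply: sume_ge0 => l _.
  by rewrite mule_ge0 ?(lab_cost_ge0 Phi01 IPhi) // lee_fin prodr_ge0.
move=> lt_n'; apply/ereal_infP => _ [l [lfeas ->]].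
have [->|finl] := eqVneq (lab_cost l) +oo; first by rewrite leey.
have := sym_ml_opt_le_blowup lt_n lfeas finl.
have := lab_cost_ge0 Phi01 (blowup_over n0 IPhi) l.
move: S0 lt_n' finl; case: (sym_ml_opt G) => [s||] //; case: (lab_cost l) => [c||] //=.
(* A zero optimum is set apart: the quotient bounding [n] then divides by zero and carries no
   information. *)
rewrite !lee_fin le_eqVlt => /orP[/eqP <-|s0] lt_n' _ c0; first by rewrite mulr0.
move=> le_s; rewrite mulrBl mul1r lerBlDr; apply: le_trans le_s _.
rewrite lerD2l ler_pdivrMr ?ltr0n // [leRHS]mulrC -ler_pdivrMr ?mulr_gt0 //.
exact: ltW.
Qed.

End Rounding.

End Blowup.

(** * Comparison of ratios and conclusion *)

Lemma eratio_le (R : realType) (c : R) (a b a' b' : \bar R) :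
  (0 < c <= 1)%R -> 0 <= b' -> b' <= b -> b <= a -> c%:E * a <= a' ->
  c%:E * eratio a b <= eratio a' b'.
Proof.
case/andP=> c0 c1 b'0 b'b ba caa'.
have b0 := le_trans b'0 b'b.
have a0 := le_trans b0 ba.
have a'0 : 0 <= a' by apply: le_trans caa'; rewrite mule_ge0 // lee_fin ltW.
case: b b'b ba b0 => [s||] //=; last first.
  (* An infinite [b] makes [a] and [a'] infinite; the right side is then at least 1 whatever [b']
     is. *)
  rewrite leye_eq => _ /eqP ay _; rewrite ay eqxx mule1.
  have a'y : a' = +oo.
    by apply/eqP; rewrite -leye_eq; move: caa'; rewrite ay gt0_muley ?lte_fin.
  rewrite a'y; case: b' b'0 => [t||] //=.
  rewrite lee_fin => t0; case: eqVneq => [_|tn0]; first by rewrite leey.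
  by rewrite gt0_mulye ?leey // lte_fin invr_gt0 lt_neqAle eq_sym tn0.
case: b' b'0 => [t||] //=; rewrite !lee_fin => t0 ts sa s0.
(* For [b'] zero the right side is infinite unless [a'] is zero; then [a] and [b] vanish, and the
   convention 0/0 = 1 leaves [c <= 1]. *)
have [tz|tn0] := eqVneq t 0%R.
  have [a'z|_] := eqVneq a' 0; last by rewrite leey.
  have az : a = 0.
    apply/eqP; rewrite eq_le (le_trans _ sa) ?lee_fin // andbT.
    by move: caa'; rewrite a'z pmule_rle0 ?lte_fin.
  have -> : s = 0%R by apply/eqP; rewrite eq_le s0 andbT; rewrite az lee_fin in sa.
  by rewrite az !eqxx mule1 lee_fin.
have t_gt0 : (0 < t)%R by rewrite lt_neqAle eq_sym tn0.
have s_gt0 := lt_le_trans t_gt0 ts.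
rewrite gt_eqF // muleA; apply: le_trans (_ : a' * (s^-1)%:E <= _).
  by rewrite lee_wpmul2r // lee_fin invr_ge0.
by rewrite lee_wpmul2l // lee_fin lef_pV2.
Qed.

Lemma eratio_ge0 (R : realType) (a b : \bar R) : 0 <= a -> 0 <= b -> 0 <= eratio a b.
Proof.
case: b => [s||] //= a0; last by case: ifP.
rewrite lee_fin => s0; case: ifP => _; first by case: ifP.
by rewrite mule_ge0 // lee_fin invr_ge0.
Qed.

Theorem theorem8 (R : realType) (q : nat) (Phi : cfun R q -> Prop) :
  bounded_arity Phi -> cost_range Phi ->
  forall (I : instance R q) (G : {group {perm ivert I}}),
    instance_over Phi I -> symmetric_under G ->
  forall eps : R, (0 < eps)%R ->
    exists I' : instance R q,
      instance_over Phi I' /\ (1 - eps)%:E * symmetry_gap G <= integrality_gap I'.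
Proof.
move=> _ Phi01 I G IPhi symG eps eps0.
(* Uses the blow-up with [n = 1], whose nonnegative LP optimum lies below [ml_opt I]. *)
have ml_ge0 : 0 <= ml_opt I.
  exact: le_trans (lp_opt_ge0 Phi01 (blowup_over (ltn0Sn 0) IPhi))
    (lp_opt_blowup Phi01 IPhi symG _).
have ml_le_sym : ml_opt I <= sym_ml_opt G.
  by apply: ereal_inf_le_tmp => _ [x [xfrac [_ ->]]]; exists x.
(* For [eps >= 1] the left side is nonpositive and [I] itself serves. *)
have [eps1|eps1] := leP 1%R eps.
  exists I; split=> //; apply: le_trans (_ : 0 <= _).
    apply: mule_le0_ge0; first by rewrite lee_fin subr_le0.
    by apply: eratio_ge0 => //; exact: le_trans ml_le_sym.
  apply: eratio_ge0; last exact: lp_opt_ge0 IPhi.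
  by apply/ereal_infP => _ [l [_ ->]]; apply: lab_cost_ge0 Phi01 IPhi _.
set k := #|ivert I|.
(* [n] must exceed both [q * k], for pruning, and the error quotient, which [Num.trunc] rounds
   down. *)
pose n0 := Num.trunc (total_weight I * (k ^ 2 + k * (q * k))%:R
  / (eps * fine (sym_ml_opt G)))%R.
pose n := (q * k + n0).+1.
exists (blowup (orbit_rep G) n); split; first exact: blowup_over.
apply: eratio_le => //.
- by rewrite subr_gt0 eps1 gerBl ltW.
- by apply: (lp_opt_ge0 Phi01); exact: blowup_over.
- exact: (lp_opt_blowup Phi01).
- apply: (int_opt_blowup Phi01) => //; first by rewrite ltnS leq_addr.
  by apply: lt_le_trans (truncnS_gt _) _; rewrite ler_nat ltnS leq_addl.
Qed.
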